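(* Let $\mathcal{H}$ be an $n$-dimensional Hilbert space, let $N\ge n$ and let $p>1$. Then $\Delta_1^p=\frac{n}{N}$ and $$\mathcal{O}_1^p=\Big\{(F,G):\ (F,G)\text{ is an }(N,n)\text{ dual pair and }\frac1N\sum_{i=1}^N\big(\|f_i\|\,\|g_i\|\big)^p=\Big(\frac{n}{N}\Big)^p\Big\}.$$
   Context: Hilbert spaces are real or complex and finite-dimensional. A sequence $F=\{f_i\}_{i=1}^N$ in $\mathcal{H}$ is a frame if there are $A,B>0$ with $A\|f\|^2\le\sum_{i=1}^N|\langle f,f_i\rangle|^2\le B\|f\|^2$ for all $f\in\mathcal{H}$. Its analysis operator is $\Theta_F f=(\langle f,f_i\rangle)_{i=1}^N$, with adjoint $\Theta_F^*(c_i)_i=\sum_i c_if_i$. A frame $G=\{g_i\}_{i=1}^N$ is a dual of $F$ if $f=\sum_{i=1}^N\langle f,f_i\rangle g_i$ for all $f\in\mathcal{H}$; then $(F,G)$ is called an $(N,n)$ dual pair. (Frames with $N$ elements exist exactly when $N\ge n$.) Let $\mathcal{D}^{(1)}$ be the set of $N\times N$ diagonal matrices with exactly one diagonal entry equal to $1$ and all others $0$. With $\|\cdot\|$ the operator norm, define $$\mathcal{O}_1^p(F,G)=\Big\{\frac1N\sum_{D\in\mathcal{D}^{(1)}}\|\Theta_G^*D\Theta_F\|^p\Big\}^{1/p},\qquad \Delta_1^p=\inf\{\mathcal{O}_1^p(F,G):(F,G)\text{ is an }(N,n)\text{ dual pair}\},$$ and let $\mathcal{O}_1^p$ be the set of $(N,n)$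 dual pairs $(F,G)$ with $\mathcal{O}_1^p(F,G)=\Delta_1^p$. (Superscript $p$ in $\mathcal{O}_1^p,\Delta_1^p$ is an index, not a power.) *)

(* Defs.v *)
From HB Require Import structures.
From mathcomp Require Import all_boot all_order all_algebra.
From mathcomp Require Import complex.
From mathcomp Require Import all_classical all_reals all_analysis.

Set Implicit Arguments.
Unset Strict Implicit.
Unset Printing Implicit Defensive.

Import Order.TTheory GRing.Theory Num.Theory.

Local Open Scope classical_set_scope.
Local Open Scope ring_scope.

(* The scalar field of a Hilbert space: the reals R or the complex numbers
   R[i], with its conjugation and its real part. *)
Variant scalar_kind := RealScalars | ComplexScalars.

Definition scalars (R : realType) (k : scalar_kind) : numFieldType :=
  match k with
  | RealScalars => R
  | ComplexScalars => R[i]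
  end.

Definition conjugate (R : realType) (k : scalar_kind) :
    scalars R k -> scalars R k :=
  match k with
  | RealScalars => fun x : R => x
  | ComplexScalars => fun z : R[i] => conjc z
  end.

Definition real_part (R : realType) (k : scalar_kind) : scalars R k -> R :=
  match k with
  | RealScalars => fun x : R => x
  | ComplexScalars => fun z : R[i] => complex.Re z
  end.

Arguments conjugate : clear implicits.
Arguments real_part {R k}.

(* A finite-dimensional Hilbert space over [scalars R k] is a [vectType] with
   an inner product; a [dot] form is linear in its first argument and
   conjugate-linear in its second one. *)
Section DualPairs.
Variables (R : realType) (k : scalar_kind).
Variables (H : vectType (scalars R k)) (dot : {dot H for conjugate R k}).
Variable N : nat.
Implicit Types (F G : 'I_N -> H) (FG : ('I_N -> H) * ('I_N -> H)).

Local Notation K := (scalars R k).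

Definition hnorm (v : H) : R := Num.sqrt (real_part (dot v v)).

(* [`|z|] lives in K; its real part is the modulus of z as an element of R. *)
Definition is_frame F : Prop :=
  exists A B : R, [/\ 0 < A, 0 < B &
    forall f : H,
      A * hnorm f ^+ 2 <= \sum_(i < N) real_part `|dot f (F i)| ^+ 2
        <= B * hnorm f ^+ 2].

Definition analysis F (f : H) : 'cV[K]_N := \col_i dot f (F i).

(* The adjoint of [analysis F] for the standard inner product of K^N. *)
Definition synthesis F (c : 'cV[K]_N) : H := \sum_(i < N) c i 0 *: F i.

Definition is_dual F G : Prop :=
  forall f : H, f = \sum_(i < N) dot f (F i) *: G i.

Definition dual_pairs : set (('I_N -> H) * ('I_N -> H)) :=
  [set FG | [/\ is_frame FG.1, is_frame FG.2 & is_dual FG.1 FG.2]].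

Definition operator_norm (T : H -> H) : R :=
  sup [set hnorm (T v) | v in [set v | hnorm v <= 1]].

(* The diagonal 0-1 matrices with exactly one diagonal entry equal to 1. *)
Definition single_erasures : set 'M[K]_N :=
  [set D | is_diag_mx D /\ exists i, forall j, D j j = (j == i)%:R].

Definition error_operator FG (D : 'M[K]_N) (f : H) : H :=
  synthesis FG.2 (D *m analysis FG.1 f).

Definition averaged_error (p : R) FG : R :=
  (N%:R^-1 * \sum_(D \in single_erasures)
               operator_norm (error_operator FG D) `^ p) `^ p^-1.

Definition optimal_error (p : R) : R :=
  inf [set averaged_error p FG | FG in dual_pairs].

Definition optimal_dual_pairs (p : R) : set (('I_N -> H) * ('I_N -> H)) :=
  [set FG | dual_pairs FG /\ averaged_error p FG = optimal_error p].

End DualPairs.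

Arguments dual_pairs {R k H} dot N.
Arguments optimal_error {R k H} dot N p.
Arguments optimal_dual_pairs {R k H} dot N p.

(* Main.v *)
Require Import Defs.
From HB Require Import structures.
From mathcomp Require Import all_boot all_order all_algebra.
From mathcomp Require Import complex ring lra.
From mathcomp Require Import all_classical all_reals all_analysis.

Set Implicit Arguments.
Unset Strict Implicit.
Unset Printing Implicit Defensive.

Import Order.TTheory GRing.Theory Num.Theory.

Local Open Scope classical_set_scope.
Local Open Scope ring_scope.

(** A diagonal matrix with a single entry 1, at position [i], turns the error
    operator into the rank-one map [v |-> <v, f_i> g_i], whose norm is
    [|f_i| |g_i|] ([operator_norm_rank_one]).  Hence the averaged error of
    [(F, G)] is the [p]-th power mean of the numbers [|f_i| |g_i|]
    ([averaged_errorE]).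

    Lower bound: taking traces in [v = sum_i <v, f_i> g_i] gives
    [sum_i <g_i, f_i> = n] ([dual_trace]), so by Cauchy-Schwarz the arithmetic
    mean of the [|f_i| |g_i|] is at least [n / N], and so is their [p]-th power
    mean ([power_mean], [average_ge]).

    Attainment: it suffices to find a Parseval frame whose vectors all have
    squared norm [a = n / N], and to take [F = G].  One starts from an
    orthonormal basis padded with zeros.  The squared norms have mean [a]; if
    they are not all equal to [a], some [i] and [j] satisfy
    [|f_i|^2 < a < |f_j|^2].  A plane rotation of the pair [(f_i, f_j)] keeps
    the frame Parseval ([rotate_parseval]), and a suitable angle gives the new
    [f_i] squared norm [a] ([rotation_hits]).  Each such step decreases the
    number of vectors of the wrong norm ([equal_norm_parseval]).

    The optimal value being [n / N], the description of the optimal pairs is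
    the injectivity of [x |-> x `^ p^-1] on nonnegative reals.

    The real and complex cases are treated together: with [rdot u v] the real
    part of the inner product, the space is a real inner product space, and
    the rotations only involve real scalars. *)

(** * Real inequalities *)

(** The graph of [x |-> x `^ p] lies above its tangent at [m]; this is Young's
    inequality for [a / m] and [1]. *)
Lemma tangent_powR (R : realType) (p m a : R) :
  1 < p -> 0 < m -> 0 <= a -> m `^ p * (1 + p * (a / m - 1)) <= a `^ p.
Proof.
move=> p1 m0 a0; have p0 : 0 < p by rewrite (lt_trans ltr01).
have q0 : 0 < 1 - p^-1 by rewrite subr_gt0 invf_lt1.
have am0 : 0 <= a / m by rewrite divr_ge0// ltW.
have := @conjugate_powR R (a / m) 1 p (1 - p^-1)^-1 am0 ler01 p0.
rewrite invr_gt0 invrK => /(_ q0); rewrite addrC subrK => /(_ erefl).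
rewrite mulr1 powR1 mul1r -(ler_pM2l p0) => young.
rewrite [leRHS](_ : _ = m `^ p * (a / m) `^ p).
  rewrite ler_pM2l ?powR_gt0//; move: young.
  move: (_ `^ p) => y; move: (a / m) => x; rewrite mulrBr mulr1.
  have -> : p * (y / p + (1 - p^-1)) = y + (p - 1) by field; rewrite gt_eqF.
  by lra.
by rewrite -powRM ?(ltW m0)// mulrCA divff ?gt_eqF// mulr1.
Qed.

(** The power mean inequality, in a form that also holds for [N = 0]. *)
Lemma power_mean (R : realType) (N : nat) (p m : R) (a : 'I_N -> R) :
  1 < p -> 0 <= m -> (forall i, 0 <= a i) -> N%:R * m <= \sum_(i < N) a i ->
  N%:R * m `^ p <= \sum_(i < N) a i `^ p.
Proof.
move=> p1; have p0 : 0 < p by rewrite (lt_trans ltr01).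
rewrite le_eqVlt => /predU1P[<-|m0] a0 am.
  by rewrite powR0 ?gt_eqF// mulr0 sumr_ge0// => i _; exact: powR_ge0.
apply: le_trans (ler_sum _ (fun i _ => tangent_powR p1 m0 (a0 i))).
rewrite -mulr_sumr mulrC ler_wpM2l ?powR_ge0//.
rewrite big_split/= -mulr_sumr sumr_const card_ord lerDl.
rewrite mulr_ge0 ?(ltW p0)// sumrB sumr_const card_ord -mulr_suml subr_ge0.
by rewrite ler_pdivlMr.
Qed.

(** When [x] and [y] are the squared norms of two vectors with real inner
    product [r], the second conclusion says that [c u + s v] has squared
    norm [a]. *)
Lemma rotation_hits (R : realType) (x y r a : R) : x < a -> a < y ->
  exists c s : R, c ^+ 2 + s ^+ 2 = 1 /\
    c ^+ 2 * x + s ^+ 2 * y + 2 * c * s * r = a.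
Proof.
move=> xa ay; pose d := r ^+ 2 + (y - a) * (a - x).
have d0 : 0 <= d by rewrite addr_ge0 ?sqr_ge0// mulr_ge0// subr_ge0 ltW.
have ya : y - a != 0 by rewrite subr_eq0 gt_eqF.
(* [t = s / c] is a root of (y - a) t^2 + 2 r t + (x - a), whose reduced
   discriminant is [d]. *)
pose t := (Num.sqrt d - r) / (y - a).
have tE : x + t ^+ 2 * y + 2 * t * r = a * (1 + t ^+ 2).
  apply/eqP; rewrite -subr_eq0; apply/eqP.
  rewrite [LHS](_ : _ = (Num.sqrt d ^+ 2 - d) / (y - a)).
    by rewrite sqr_sqrtr// subrr mul0r.
  by rewrite /t /d; field.
have t1 : 0 < 1 + t ^+ 2 by rewrite ltr_pwDl// sqr_ge0.
pose c := (Num.sqrt (1 + t ^+ 2))^-1.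
have cE : c ^+ 2 = (1 + t ^+ 2)^-1 by rewrite exprVn sqr_sqrtr// ltW.
exists c, (t * c); split.
  by rewrite exprMn cE; field; rewrite gt_eqF.
transitivity (c ^+ 2 * (x + t ^+ 2 * y + 2 * t * r)); first by ring.
by rewrite tE cE mulrCA mulVf ?mulr1// gt_eqF.
Qed.

Lemma exists_lt_mean (R : realType) (N : nat) (a : R) (x : 'I_N -> R)
    (i : 'I_N) :
  \sum_(l < N) x l = N%:R * a -> x i != a -> exists j, x j < a.
Proof.
move=> sx xi; apply/existsP; apply: contraR xi => /existsPn no.
have x_ge l : true -> 0 <= x l - a by rewrite subr_ge0 leNgt no.
have : \sum_(l < N) (x l - a) = 0.
  by rewrite sumrB sx sumr_const card_ord mulr_natl subrr.
by move=> /(psumr_eq0P x_ge)/(_ i isT)/eqP; rewrite subr_eq0.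
Qed.

(** * Real and complex scalars *)

Section Scalars.
Variables (R : realType) (k : scalar_kind).
Local Notation K := (scalars R k).
Implicit Types (x y : R) (z w : K).

(** The embedding of the reals into the scalar field. *)
Definition real_scalar : R -> K :=
  match k return R -> scalars R k with
  | RealScalars => fun x => x
  | ComplexScalars => fun x => x%:C%C
  end.

(** The modulus of a scalar, as a real number. *)
Definition modulus z : R := real_part `|z|.

Lemma real_scalarD x y : real_scalar (x + y) = real_scalar x + real_scalar y.
Proof. by rewrite /real_scalar; case: k => //=; rewrite rmorphD. Qed.

Lemma real_scalarM x y : real_scalar (x * y) = real_scalar x * real_scalar y.
Proof. by rewrite /real_scalar; case: k => //=; rewrite rmorphM. Qed.

Lemma real_scalarN x : real_scalar (- x) = - real_scalar x.
Proof. by rewrite /real_scalar; case: k => //=; rewrite rmorphN. Qed.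

Lemma real_scalar0 : real_scalar 0 = 0.
Proof. by rewrite /real_scalar; case: k. Qed.

Lemma real_scalar1 : real_scalar 1 = 1.
Proof. by rewrite /real_scalar; case: k. Qed.

Lemma real_part_scalar x z : real_part (real_scalar x * z) = x * real_part z.
Proof.
rewrite /real_scalar; case: k z => //= -[a b].
by change (x * a - 0 * b = x * a); rewrite mul0r subr0.
Qed.

Lemma real_partK x : real_part (real_scalar x : K) = x.
Proof. by rewrite /real_scalar; case: k. Qed.

Lemma conjugate_scalar x : conjugate R k (real_scalar x) = real_scalar x.
Proof. by rewrite /real_scalar; case: k => //=; rewrite oppr0. Qed.

Lemma conjugateK z : conjugate R k (conjugate R k z) = z.
Proof. by case: k z => //= z; rewrite conjcK. Qed.

Lemma real_partD z w : real_part (z + w) = real_part z + real_part w.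
Proof. by case: k z w => //= -[a b] [c d]. Qed.

Lemma real_part0 : real_part (0 : K) = 0.
Proof. by case: k. Qed.

Lemma real_part_sum I (r : seq I) (P : pred I) (F : I -> K) :
  real_part (\sum_(i <- r | P i) F i) = \sum_(i <- r | P i) real_part (F i).
Proof. by apply: (big_morph _ real_partD real_part0). Qed.

Lemma real_part_conjugate z : real_part (conjugate R k z) = real_part z.
Proof. by case: k z => //= -[a b]. Qed.

Lemma real_part_nat m : real_part (m%:R : K) = m%:R.
Proof.
elim: m => [|m IH]; first exact: real_part0.
by rewrite -!natr1 real_partD IH; case: k.
Qed.

Lemma real_part_gt0 z : 0 < z -> 0 < real_part z.
Proof. by case: k z => //= -[a b]; rewrite ltcE /= => /andP[]. Qed.

Lemma gt0_real_scalar z : 0 < z -> z = real_scalar (real_part z).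
Proof.
rewrite /real_scalar; case: k z => //= -[a b].
by rewrite ltcE /= => /andP[/eqP -> _].
Qed.

Lemma modulus_ge0 z : 0 <= modulus z.
Proof.
rewrite /modulus; have := normr_ge0 z.
rewrite le_eqVlt => /predU1P[<-|/real_part_gt0/ltW//]; by rewrite real_part0.
Qed.

Lemma mul_conjugate z : z * conjugate R k z = real_scalar (modulus z ^+ 2).
Proof.
rewrite /modulus /real_scalar; case: k z => z /=.
  by rewrite -normrX ger0_norm ?sqr_ge0 ?expr2.
by rewrite -sqr_normc rmorphXn; congr (_ ^+ 2).
Qed.

Lemma modulus_sqr z : modulus z ^+ 2 = real_part (z * conjugate R k z).
Proof. by rewrite mul_conjugate /real_scalar; case: k. Qed.

Lemma modulus_conjugate z : modulus (conjugate R k z) = modulus z.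
Proof.
apply/eqP; rewrite -(@eqrXn2 _ 2) ?modulus_ge0//.
by rewrite !modulus_sqr conjugateK mulrC.
Qed.

Lemma modulus_scalar x : modulus (real_scalar x : K) = `|x|.
Proof.
apply/eqP; rewrite -(@eqrXn2 _ 2) ?modulus_ge0// modulus_sqr conjugate_scalar.
by rewrite real_part_scalar -normrX ger0_norm ?sqr_ge0// real_partK expr2.
Qed.

End Scalars.
Arguments real_scalar {R k}.
Arguments modulus {R k}.

(** * The inner product space *)

Section InnerProduct.
Variables (R : realType) (k : scalar_kind).
Variables (H : vectType (scalars R k)) (dot : {dot H for conjugate R k}).
Local Notation K := (scalars R k).
Implicit Types (x y : R) (c : K) (u v w : H).

Lemma dotDl u v w : dot (u + v) w = dot u w + dot v w.
Proof. exact: linearDl. Qed.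

Lemma dotDr u v w : dot u (v + w) = dot u v + dot u w.
Proof. exact: linearDr. Qed.

Lemma dotBl u v w : dot (u - v) w = dot u w - dot v w.
Proof. exact: linearBl. Qed.

Lemma dot0l v : dot 0 v = 0.
Proof. exact: linear0l. Qed.

Lemma dotZl c u v : dot (c *: u) v = c * dot u v.
Proof. exact: linearZl_LR. Qed.

Lemma dotZr c u v : dot u (c *: v) = conjugate R k c * dot u v.
Proof. exact: linearZr_LR. Qed.

Lemma dotC u v : dot u v = conjugate R k (dot v u).
Proof. by rewrite (hermitian_subproof u v) /= expr0 mul1r. Qed.

Lemma dot_suml I (r : seq I) (P : pred I) (F : I -> H) v :
  dot (\sum_(i <- r | P i) F i) v = \sum_(i <- r | P i) dot (F i) v.
Proof. exact: linear_sumlz. Qed.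

(** The real inner product underlying [dot]. *)
Definition rdot u v : R := real_part (dot u v).

Lemma rdotC u v : rdot u v = rdot v u.
Proof. by rewrite /rdot dotC real_part_conjugate. Qed.

Lemma rdotDl u v w : rdot (u + v) w = rdot u w + rdot v w.
Proof. by rewrite /rdot dotDl real_partD. Qed.

Lemma rdotDr u v w : rdot u (v + w) = rdot u v + rdot u w.
Proof. by rewrite /rdot dotDr real_partD. Qed.

Lemma rdotZl x u v : rdot (real_scalar x *: u) v = x * rdot u v.
Proof. by rewrite /rdot dotZl real_part_scalar. Qed.

Lemma rdotZr x u v : rdot u (real_scalar x *: v) = x * rdot u v.
Proof. by rewrite /rdot dotZr conjugate_scalar real_part_scalar. Qed.

Lemma rdot_gt0 u : u != 0 -> 0 < rdot u u.
Proof. by move=> /(@neq0_dnorm_gt0 _ _ _ dot) /real_part_gt0. Qed.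

Lemma rdot_ge0 u : 0 <= rdot u u.
Proof.
have [->|/rdot_gt0/ltW//] := eqVneq u 0.
by rewrite /rdot dot0l real_part0.
Qed.

Lemma dot_rdot u : dot u u = real_scalar (rdot u u).
Proof.
have [->|u0] := eqVneq u 0; last exact/gt0_real_scalar/neq0_dnorm_gt0.
by rewrite /rdot dot0l real_part0 real_scalar0.
Qed.

Lemma hnorm_ge0 u : 0 <= hnorm dot u.
Proof. exact: sqrtr_ge0. Qed.

Lemma hnorm_sqr u : hnorm dot u ^+ 2 = rdot u u.
Proof. by rewrite sqr_sqrtr ?rdot_ge0. Qed.

Lemma hnorm0 : hnorm dot 0 = 0.
Proof. by rewrite /hnorm dot0l real_part0 sqrtr0. Qed.

Lemma hnorm_gt0 u : u != 0 -> 0 < hnorm dot u.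
Proof. by move=> /rdot_gt0; rewrite sqrtr_gt0. Qed.

Lemma hnormZ c u : hnorm dot (c *: u) = modulus c * hnorm dot u.
Proof.
apply/eqP; rewrite -(@eqrXn2 _ 2) ?mulr_ge0 ?hnorm_ge0 ?modulus_ge0//.
rewrite exprMn !hnorm_sqr /rdot dotZl dotZr mulrA mul_conjugate.
by rewrite real_part_scalar.
Qed.

(** Cauchy-Schwarz for the underlying real inner product. *)
Lemma rdot_le u v : rdot u v <= hnorm dot u * hnorm dot v.
Proof.
have [->|v0] := eqVneq v 0.
  by rewrite hnorm0 mulr0 rdotC /rdot dot0l real_part0.
rewrite real_leNgt ?num_real//; apply/negP => lt_uv.
have uv0 : 0 <= hnorm dot u * hnorm dot v by rewrite mulr_ge0 ?hnorm_ge0.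
have lt2 : rdot u u * rdot v v < rdot u v ^+ 2.
  by rewrite -!hnorm_sqr -exprMn ltrXn2r// (le_lt_trans uv0).
(* The squared norm of |v|^2 u - <u, v> v is |v|^2 (|u|^2 |v|^2 - <u, v>^2). *)
have := rdot_ge0 (real_scalar (rdot v v) *: u + real_scalar (- rdot u v) *: v).
apply/negP; rewrite -ltNge.
rewrite !(rdotDl, rdotDr, rdotZl, rdotZr) (rdotC v u).
rewrite [ltLHS](_ : _ = rdot v v * (rdot u u * rdot v v - rdot u v ^+ 2)).
  by rewrite pmulr_rlt0 ?rdot_gt0// subr_lt0.
by ring.
Qed.

Lemma modulus_dot_le u v : modulus (dot u v) <= hnorm dot u * hnorm dot v.
Proof.
have := modulus_ge0 (dot u v); rewrite le_eqVlt => /predU1P[<-|m0].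
  by rewrite mulr_ge0 ?hnorm_ge0.
(* With [c] the conjugate of [dot u v], the squared modulus is [rdot (c u) v],
   to which the real inequality applies. *)
rewrite -(ler_pM2l m0) -expr2 modulus_sqr mulrC -dotZl mulrA.
by rewrite -modulus_conjugate -hnormZ rdot_le.
Qed.

Lemma operator_norm_rank_one f g :
  operator_norm dot (fun v => dot v f *: g) = hnorm dot f * hnorm dot g.
Proof.
rewrite /operator_norm; set E := [set _ | _ in _].
have E_ub : ubound E (hnorm dot f * hnorm dot g).
  move=> _ [v /= v1 <-]; rewrite hnormZ ler_wpM2r ?hnorm_ge0//.
  by rewrite (le_trans (modulus_dot_le _ _))// ler_piMl ?hnorm_ge0.
have E0 : E 0.
  exists 0; rewrite /= ?hnorm0 ?ler01//.
  by rewrite dot0l scale0r hnorm0.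
apply/le_anti/andP; split; first by apply: ge_sup => //; exists 0.
apply: ub_le_sup; first by exists (hnorm dot f * hnorm dot g).
have [->|f0] := eqVneq f 0; first by rewrite hnorm0 mul0r.
have nf := hnorm_gt0 f0.
(* The norm is attained at the normalized vector f / |f|. *)
exists (real_scalar (hnorm dot f)^-1 *: f).
  rewrite /= hnormZ modulus_scalar ger0_norm ?invr_ge0 ?hnorm_ge0//.
  by rewrite mulVf ?gt_eqF.
rewrite hnormZ; congr (_ * _).
rewrite dotZl dot_rdot -real_scalarM modulus_scalar -hnorm_sqr.
by rewrite expr2 mulKf ?gt_eqF// ger0_norm ?hnorm_ge0.
Qed.

(** * Dual pairs and their averaged error *)

Section Families.
Variable N : nat.
Implicit Types F G : 'I_N -> H.

(** The trace of the identity, computed in a basis from its expression as a sum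
    of the rank-one maps [v |-> <v, f_i> g_i]. *)
Lemma dual_trace F G :
  is_dual dot F G -> \sum_(i < N) rdot (G i) (F i) = (\dim {: H})%:R.
Proof.
move=> FG; pose b := vbasis {: H}.
have bE j : b`_j = \sum_(i < N) dot b`_j (F i) *: G i by exact: FG.
have coordE (v : H) : v = \sum_(j < \dim {: H}) coord b j v *: b`_j.
  exact/coord_vbasis/memvf.
rewrite /rdot -real_part_sum -(real_part_nat R k); congr real_part.
rewrite [RHS](_ : _ = \sum_(j < \dim {: H}) coord b j b`_j); last first.
  rewrite -[in LHS](card_ord (\dim {: H})) -sumr_const.
  by apply: eq_bigr => j _; rewrite coord_free ?eqxx// (basis_free (vbasisP _)).
pose T j i := coord b j (dot b`_j (F i) *: G i).
rewrite [RHS](eq_bigr (fun j => \sum_(i < N) T j i)); last first.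
  by move=> j _; rewrite -linear_sum -bE.
rewrite [RHS]exchange_big; apply: eq_bigr => i _ /=.
rewrite {1}[G i]coordE dot_suml; apply: eq_bigr => j _.
by rewrite dotZl /T linearZ mulrC.
Qed.

Lemma error_operator_delta F G (i : 'I_N) :
  error_operator dot (F, G) (delta_mx i i) = fun v => dot v (F i) *: G i.
Proof.
apply/funext => v; rewrite /error_operator /synthesis /=.
rewrite (bigD1 i)//= big1 ?addr0 => [|j ji].
  rewrite mxE (bigD1 i)//= big1 ?addr0 => [|l li].
    by rewrite !mxE !eqxx mul1r.
  by rewrite !mxE (negPf li) andbF mul0r.
rewrite mxE big1 ?scale0r// => l _.
by rewrite !mxE (negPf ji) mul0r.
Qed.

Lemma single_erasuresE :
  @single_erasures R k N = [set delta_mx i i | i in [set: 'I_N]].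
Proof.
have offdiag (i j l : 'I_N) : j != l -> (j == i) && (l == i) = false.
  by move=> jl; apply/negP => /andP[/eqP ji /eqP li]; rewrite ji li eqxx in jl.
apply/seteqP; split => [D [/is_diag_mxP Ddiag [i Di]]|_ [i _ <-]].
  exists i => //; apply/matrixP => j l; rewrite mxE.
  have [->|jl] := eqVneq j l; first by rewrite Di andbb.
  by rewrite Ddiag// offdiag.
split; first by apply/is_diag_mxP => j l jl; rewrite mxE offdiag.
by exists i => j; rewrite mxE andbb.
Qed.

Lemma sum_single_erasures (h : 'M[K]_N -> R) :
  \sum_(D \in @single_erasures R k N) h D = \sum_(i < N) h (delta_mx i i).
Proof.
rewrite single_erasuresE fsbig_image.
  rewrite [RHS](fsbig_seq _ _ (index_enum_uniq _)); apply: eq_fsbigl.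
  by apply/seteqP; split => // i _; rewrite /= mem_index_enum.
move=> i j _ _ /matrixP/(_ i i); rewrite !mxE !eqxx andbb/=.
by case: eqVneq => // _ /eqP; rewrite oner_eq0.
Qed.

(** The mean of the [(|f_i| |g_i|) `^ p]; it is [0] for [N = 0]. *)
Definition average (p : R) (FG : ('I_N -> H) * ('I_N -> H)) : R :=
  N%:R^-1 * \sum_(i < N) (hnorm dot (FG.1 i) * hnorm dot (FG.2 i)) `^ p.

Lemma averaged_errorE p FG : averaged_error dot p FG = average p FG `^ p^-1.
Proof.
rewrite /averaged_error /average sum_single_erasures.
congr ((_ * _) `^ _); apply: eq_bigr => i _; case: FG => F G.
by rewrite error_operator_delta operator_norm_rank_one.
Qed.

Lemma trace_le_hnorm F G : is_dual dot F G ->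
  (\dim {: H})%:R <= \sum_(i < N) hnorm dot (F i) * hnorm dot (G i).
Proof.
move=> /dual_trace <-; apply: ler_sum => i _.
by rewrite mulrC rdot_le.
Qed.

Lemma average_ge p F G : 1 < p -> is_dual dot F G ->
  ((\dim {: H})%:R / N%:R) `^ p <= average p (F, G).
Proof.
move=> p1 FG; have p0 : 0 < p by rewrite (lt_trans ltr01).
case: (posnP N) => [N0|N0].
  have Ninv : N%:R^-1 = 0 :> R by rewrite N0 invr0.
  by rewrite /average Ninv mulr0 mul0r powR0 ?gt_eqF.
have N0' : 0 < N%:R :> R by rewrite ltr0n.
rewrite -(ler_pM2l N0') mulVKf ?gt_eqF//=.
apply: (power_mean p1) => [|i|].
- by rewrite divr_ge0.
- by rewrite mulr_ge0 ?hnorm_ge0.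
- by rewrite mulrC divfK ?gt_eqF//; exact: trace_le_hnorm.
Qed.

Lemma parseval_is_frame F : is_dual dot F F -> is_frame dot F.
Proof.
move=> FF; exists 1, 1; split => // f; rewrite mul1r hnorm_sqr.
rewrite (_ : rdot f f = \sum_(i < N) modulus (dot f (F i)) ^+ 2) ?lexx//.
rewrite /rdot {1}[f]FF dot_suml real_part_sum; apply: eq_bigr => i _.
by rewrite modulus_sqr dotZl [dot (F i) f]dotC.
Qed.

(** * Parseval frames with vectors of equal norm *)

(** A family [F] with [is_dual dot F F] is a Parseval frame; rotating two of its
    vectors leaves the sum of the rank-one maps [v |-> <v, f_i> f_i]
    unchanged. *)
Lemma rotate_parseval F (i j : 'I_N) (c s : R) :
  i != j -> c ^+ 2 + s ^+ 2 = 1 -> is_dual dot F F ->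
  let F' := fun l =>
    if l == i then real_scalar c *: F i + real_scalar s *: F j
    else if l == j then real_scalar (- s) *: F i + real_scalar c *: F j
    else F l in
  is_dual dot F' F'.
Proof.
move=> ij cs1 FF F' f; rewrite {1}[f]FF.
have ji : j != i by rewrite eq_sym.
rewrite (bigD1 i)//= (bigD1 j)//= [in RHS](bigD1 i)//= [in RHS](bigD1 j)//=.
rewrite !addrA; congr (_ + _); last first.
  by apply: eq_bigr => l /andP[li lj]; rewrite /F' (negPf li) (negPf lj).
rewrite /F' !eqxx (negPf ji) !dotDr !dotZr !conjugate_scalar.
move: (dot f (F i)) (dot f (F j)) => x y.
rewrite real_scalarN !scalerDr !scalerA.
have {}cs1 : real_scalar c ^+ 2 + real_scalar s ^+ 2 = 1 :> K.
  by rewrite !expr2 -!real_scalarM -real_scalarD -!expr2 cs1 real_scalar1.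
move: (real_scalar c) (real_scalar s) cs1 => C S cs1.
rewrite addrACA -!scalerDl; congr (_ *: _ + _ *: _).
- rewrite -[LHS]mul1r -cs1; ring.
- rewrite -[LHS]mul1r -cs1; ring.
Qed.

Lemma equal_norm_parseval F (a : R) : N%:R * a = (\dim {: H})%:R ->
  is_dual dot F F ->
  exists F', is_dual dot F' F' /\ forall i, rdot (F' i) (F' i) = a.
Proof.
move=> Na; have [m] := ubnP #|[pred i | rdot (F i) (F i) != a]|.
elim: m F => // m IH F; rewrite ltnS => cF FF.
have [/existsP[i0 bad]|] := boolP [exists i, rdot (F i) (F i) != a]; last first.
  move=> /existsPn no; exists F; split => // i.
  by apply/eqP; have := no i; rewrite negbK.
have tr : \sum_(l < N) rdot (F l) (F l) = N%:R * a by rewrite dual_trace.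
(* The squared norms and their opposites each have an entry below the mean. *)
have [i lti] := exists_lt_mean tr bad.
have [j ltj] : exists j, a < rdot (F j) (F j).
  have [] := @exists_lt_mean _ _ (- a) (fun l => - rdot (F l) (F l)) i0.
  - by rewrite sumrN tr mulrN.
  - by rewrite eqr_opp.
  by move=> j; rewrite ltrN2; exists j.
have ij : i != j.
  by apply: contraTneq lti => ->; rewrite -leNgt ltW.
have [c [s [cs1 hit]]] := rotation_hits (rdot (F i) (F j)) lti ltj.
have := rotate_parseval ij cs1 FF.
set F' := (fun l => _) => /= FF'.
have F'i : rdot (F' i) (F' i) = a.
  rewrite /F' eqxx !(rdotDl, rdotDr, rdotZl, rdotZr) -hit (rdotC (F j) (F i)).
  by ring.
apply: (IH F') => //; apply: leq_trans cF.
apply/proper_card/properP; split; last first.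
  by exists i; rewrite inE ?F'i ?eqxx// lt_eqF.
apply/fintype.subsetP => l; rewrite !inE.
have [->|li] := eqVneq l i; first by rewrite F'i eqxx.
have [->|lj] := eqVneq l j; first by move=> _; rewrite gt_eqF.
by rewrite /F' (negPf li) (negPf lj).
Qed.

End Families.

(** Orthonormality of a finite family. *)
Definition orthonormal_family m (X : 'I_m -> H) : Prop :=
  forall i j, dot (X i) (X j) = (i == j)%:R.

Lemma orthonormal_le_dim m (X : 'I_m -> H) :
  orthonormal_family X -> (m <= \dim {: H})%N.
Proof.
move=> Xon; pose t := [tuple X i | i < m].
have : free t.
  apply/freeP => c c0 i; have := congr1 (fun v => dot v (X i)) c0.
  rewrite /= dot0l dot_suml (bigD1 i)//= big1 ?addr0 => [|l li].
    by rewrite dotZl nth_mktuple Xon eqxx mulr1.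
  by rewrite dotZl nth_mktuple Xon (negPf li) mulr0.
rewrite /free => /eqP; rewrite size_tuple => <-.
exact/dimvS/subvf.
Qed.

(** The extended family consists of the normalization of [w] followed by [X]. *)
Lemma orthonormal_extend m (X : 'I_m -> H) (w : H) :
  orthonormal_family X -> w != 0 -> (forall i, dot w (X i) = 0) ->
  exists X' : 'I_m.+1 -> H, orthonormal_family X'.
Proof.
move=> Xon w0 wX; have nw := hnorm_gt0 w0.
pose e := real_scalar (hnorm dot w)^-1 *: w.
have eX i : dot e (X i) = 0 by rewrite dotZl wX mulr0.
have ee : dot e e = 1.
  rewrite dotZl dotZr conjugate_scalar dot_rdot -!real_scalarM -hnorm_sqr.
  by rewrite expr2 mulKf ?gt_eqF// mulVf ?gt_eqF// real_scalar1.
exists (fun i => if unlift ord0 i is Some l then X l else e) => i j.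
case: (unliftP ord0 i) => [i' ->|->]; case: (unliftP ord0 j) => [j' ->|->].
- by rewrite Xon (inj_eq lift_inj).
- rewrite dotC eX -(real_scalar0 R k) conjugate_scalar real_scalar0.
  by rewrite eq_sym (negPf (neq_lift _ _)).
- by rewrite eX (negPf (neq_lift _ _)).
- by rewrite eqxx.
Qed.

(** An orthonormal family of maximal size is Parseval: otherwise the residual
    [f - sum_i <f, x_i> x_i] of some [f] would extend it. *)
Lemma exists_orthonormal_basis : exists m (X : 'I_m -> H),
  orthonormal_family X /\ is_dual dot X X.
Proof.
pose P m := `[< exists X : 'I_m -> H, orthonormal_family X >].
have P0 : exists m, P m.
  by exists 0%N; apply/asboolP; exists (fun=> 0) => -[].
have Pdim m : P m -> (m <= \dim {: H})%N.
  by move=> /asboolP[X]; exact: orthonormal_le_dim.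
case: (ex_maxnP P0 Pdim) => m /asboolP[X Xon] mmax.
exists m, X; split => // f; apply/eqP; rewrite -subr_eq0.
apply/negPn/negP => w0.
suff /mmax : P m.+1 by rewrite ltnn.
apply/asboolP; apply: (orthonormal_extend Xon w0) => i.
rewrite dotBl dot_suml (bigD1 i)//= big1 ?addr0 => [|l li].
  by rewrite dotZl Xon eqxx mulr1 subrr.
by rewrite dotZl Xon (negPf li) mulr0.
Qed.

Lemma exists_parseval N : (\dim {: H} <= N)%N ->
  exists F : 'I_N -> H, is_dual dot F F.
Proof.
have [m [X [Xon XX]]] := exists_orthonormal_basis => dimN.
have mN : (m <= N)%N by rewrite (leq_trans _ dimN) ?(orthonormal_le_dim Xon).
pose Y (l : nat) := if insub l is Some i then X i else 0.
(* [Y] is the orthonormal basis padded with zeros. *)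
exists (fun i : 'I_N => Y i) => f.
rewrite (bigID (fun i : 'I_N => (i < m)%N))/=.
rewrite [X in _ + X]big1 ?addr0; last first.
  by move=> i; rewrite /Y => /negPf im; rewrite insubF ?scaler0.
rewrite -(big_ord_widen N (fun i => dot f (Y i) *: Y i) mN) {1}[f]XX.
by apply: eq_bigr => i _; rewrite /Y valK.
Qed.

Lemma exists_uniform_dual_pair N : (\dim {: H} <= N)%N ->
  exists2 FG, dual_pairs dot N FG &
    forall i, hnorm dot (FG.1 i) * hnorm dot (FG.2 i) = (\dim {: H})%:R / N%:R.
Proof.
move=> dimN; have [F0 FF0] := exists_parseval dimN.
(* For [N = 0] this relies on [dim H = 0], the quotient being 0. *)
have Na : N%:R * ((\dim {: H})%:R / N%:R) = (\dim {: H})%:R :> R.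
  case: (posnP N) dimN => [->|N0 _]; last first.
    by rewrite mulrC divfK// pnatr_eq0 gtn_eqF.
  by rewrite leqn0 => /eqP ->; rewrite mul0r.
have [F [FF Fa]] := equal_norm_parseval Na FF0.
exists (F, F) => [|i]; last by rewrite /= -expr2 hnorm_sqr.
by split => //; exact: parseval_is_frame.
Qed.

End InnerProduct.

(** * The optimal error and the optimal pairs *)

Theorem proposition4p1 (R : realType) (k : scalar_kind)
    (H : vectType (scalars R k)) (dot : {dot H for conjugate R k})
    (n N : nat) (p : R) (dimH : \dim {: H} = n) (n_le_N : (n <= N)%N)
    (p_gt1 : 1 < p) :
  optimal_error dot N p = n%:R / N%:R /\
  optimal_dual_pairs dot N p =
    [set FG | dual_pairs dot N FG /\
       N%:R^-1 * \sum_(i < N) (hnorm dot (FG.1 i) * hnorm dot (FG.2 i)) `^ p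
         = (n%:R / N%:R) `^ p].
Proof.
have p0 : 0 < p by rewrite (lt_trans ltr01).
have pV0 : 0 < p^-1 by rewrite invr_gt0.
pose r : R := n%:R / N%:R.
have r0 : 0 <= r by rewrite divr_ge0.
have rE : (r `^ p) `^ p^-1 = r by rewrite -powRrM divff ?gt_eqF// powRr1.
have avg0 FG : 0 <= average dot p FG.
  by rewrite mulr_ge0// sumr_ge0// => i _; exact: powR_ge0.
have lower FG : dual_pairs dot N FG -> r <= averaged_error dot p FG.
  case: FG => F G [_ _ FG]; rewrite averaged_errorE -rE.
  rewrite ge0_ler_powR ?nnegrE ?powR_ge0 ?(ltW pV0)//.
  by rewrite /r -dimH average_ge.
have [FG0 dFG0 uFG0] : exists2 FG, dual_pairs dot N FG &
    forall i, hnorm dot (FG.1 i) * hnorm dot (FG.2 i) = r.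
  by rewrite /r -dimH; apply: exists_uniform_dual_pair; rewrite dimH.
have attained : averaged_error dot p FG0 = r.
  rewrite averaged_errorE -[RHS]rE; congr (_ `^ _).
  rewrite /average (eq_bigr (fun=> r `^ p)) => [|i _]; last by rewrite uFG0.
  rewrite sumr_const card_ord -[_ `^ p *+ N]mulr_natl mulrA.
  have [N0|N0] := eqVneq (N%:R : R) 0; last by rewrite mulVf// mul1r.
  have -> : r = 0 by rewrite /r N0 invr0 mulr0.
  by rewrite powR0 ?gt_eqF// mulr0.
have optE : optimal_error dot N p = r.
  apply/le_anti/andP; split.
    rewrite -attained; apply: ge_inf; last by exists FG0.
    by exists r => _ [FG dFG <-]; exact: lower.
  apply: lb_le_inf; first by exists r, FG0.
  by move=> _ [FG dFG <-]; exact: lower.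
split; first exact: optE.
rewrite /optimal_dual_pairs optE.
apply/seteqP; split => FG -[dFG eFG]; (split; first exact: dFG).
  apply: (powR_injective pV0); rewrite ?nnegrE ?powR_ge0//.
    exact: avg0.
  by rewrite -averaged_errorE -/r rE.
by rewrite averaged_errorE /average eFG.
Qed.
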